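(* Let $X=\prod_{j=1}^\infty X_j$ be a product of completely regular spaces $X_j$ with $\mathrm{ind}(X_j)=0$, let $\mu_j,\nu_j:E(X_j)\to\mathbf K_s$ be probability measures with values in $\mathbf K_s$, and let $\nu=\bigotimes_{j=1}^\infty\nu_j$, $\mu=\bigotimes_{j=1}^\infty\mu_j$ be the product probability measures on $E(X)$. If $\mu\ll\nu$, then $\mu_j\ll\nu_j$ for each $j$ and $\prod_{j=1}^\infty\beta_j$ converges to some $\beta$ with $0<\beta<\infty$, where $\beta_j=\|\rho_j\|_{\phi_j}$, $\rho_j(x)=\mu_j(dx)/\nu_j(dx)$ and $\phi_j(x)=N_{\nu_j}(x)$.
   Context: $s$ is a prime and $\mathbf K_s$ is a finite algebraic extension of $\mathbf Q_s$ with the norm extending that of $\mathbf Q_s$. $\mathrm{ind}$ is the small inductive dimension; $Bco(X)$ is the algebra of clopen subsets of $X$; $E(X)$ denotes an algebra of subsets of $X$ containing $Bco(X)$. A $\mathbf K_s$-valued measure on $E$ is $\mu:E\to\mathbf K_s$ such that: (i) $\mu$ is additive, $\mu(\emptyset)=0$; (ii) $\|A\|_\mu:=\sup\{|\mu(B)|:B\in E,B\subset A\}<\infty$; (iii) if $F\subset E$ is shrinking (for $A,B\in F$ there is $C\in F$ with $C\subset A\cap B$) and $\bigcap F=\emptyset$, then $\lim_{A\in F}\mu(A)=0$. Probability: $\|X\|_\mu=1=\mu(X)$. $N_\mu(x):=\inf\{\|U\|_\mu:x\in U\in Bco(X)\}$; $\|f\|_\phi:=\sup_x|f(x)|\phi(x)$.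 $L(X,\mu,\mathbf K_s)$ is the Banach space of classes of $\mu$-integrable functions with norm $\|f\|_{N_\mu}$ (limits of $E$-simple functions). $\nu\ll\mu$ means there is $f\in L(X,\mu,\mathbf K_s)$ with $\nu(A)=\int_Af\,d\mu$ for all $A\in Bco(X)$; then $f=:\nu(dx)/\mu(dx)$. *)

(* Defs.v *)
From HB Require Import structures.
From mathcomp Require Import all_boot all_order all_algebra all_field.
From mathcomp Require Import all_classical all_reals all_analysis.

Set Implicit Arguments.
Unset Strict Implicit.
Unset Printing Implicit Defensive.
Import Order.TTheory GRing.Theory Num.Theory.
Import numFieldNormedType.Exports.
Local Open Scope classical_set_scope.
Local Open Scope ring_scope.

(** * The field [Q_s] and its finite extensions *)

Definition padic_abs (R : realType) (s : nat) (r : rat) : R :=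
  if r == 0 then 0
  else s%:R ^+ logn s `|denq r|%N / s%:R ^+ logn s `|numq r|%N.

Definition nonarch_abs (R : realType) (F : fieldType) (v : F -> R) : Prop :=
  [/\ forall x, 0 <= v x,
      forall x, v x = 0 <-> x = 0,
      forall x y, v (x * y) = v x * v y &
      forall x y, v (x + y) <= Num.max (v x) (v y)].

Definition abs_complete (R : realType) (F : fieldType) (v : F -> R) : Prop :=
  forall u : nat -> F,
    (forall e : R, 0 < e -> exists N : nat, forall m n : nat,
       (N <= m)%N -> (N <= n)%N -> v (u m - u n) < e) ->
    exists l : F, v (u n - l) @[n --> \oo] --> (0 : R).

(* [(F, v)] is the completion of [rat] for the [s]-adic absolute value, which
   determines it up to a unique isometric isomorphism.  The second clause makes
   [F] of characteristic 0, so that [ratr] is the embedding of [rat]. *)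
Definition is_Qs (R : realType) (s : nat) (F : fieldType) (v : F -> R) : Prop :=
  [/\ nonarch_abs v,
      forall r : rat, v (ratr r) = padic_abs R s r,
      abs_complete v &
      forall (x : F) (e : R), 0 < e -> exists r : rat, v (x - ratr r) < e].

Definition is_finite_ext_of_Qs (R : realType) (s : nat)
    (Qs : fieldType) (absQ : Qs -> R)
    (K : fieldExtType Qs) (absK : K -> R) : Prop :=
  [/\ is_Qs s absQ, nonarch_abs absK & forall a : Qs, absK a%:A = absQ a].

(** * Small inductive dimension *)

(* [ind_lt n T] is [ind T <= n - 1]; the shift accommodates [ind = -1], which
   holds exactly for the empty space.  For [U] open, the frontier of [U] is
   [closure U `\` U]; it carries the subspace topology through [set_type]. *)
Fixpoint ind_lt (n : nat) (T : topologicalType) : Prop :=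
  match n with
  | 0 => [set: T] = set0
  | m.+1 => forall (x : T) (V : set T), open V -> V x ->
      exists U : set T, [/\ open U, U x, U `<=` V &
        ind_lt m (set_type (closure U `\` U))]
  end.

Definition has_ind (n : nat) (T : topologicalType) : Prop :=
  ind_lt n.+1 T /\ ~ ind_lt n T.

(* Complete regularity includes the T1 axiom, as in Engelking's book; the
   library's [completely_regular_space] does not. *)
Definition T1_completely_regular (T : topologicalType) : Prop :=
  accessible_space T /\ completely_regular_space T.

(** * Measures with values in a non-Archimedean field *)

Section measures.
Context {R : realType} {K : fieldType} (v : K -> R) {T : topologicalType}.
Implicit Types (E : set (set T)) (mu nu : set T -> K) (f : T -> K).

(* The algebra [Bco(T)] is [@clopen T]; it contains [setT], so that the ring of
   sets [E] below is an algebra. *)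
Definition algebra_over_Bco E : Prop := setring E /\ @clopen T `<=` E.

(* A measure on [E] is given by a function on all subsets of [T], of which only
   the values on [E] are relevant. *)
Definition setnorm E mu (A : set T) : \bar R :=
  ereal_sup [set (v (mu B))%:E | B in [set B | E B /\ B `<=` A]].

Definition shrinking (F : set (set T)) : Prop :=
  forall A B, F A -> F B -> exists2 C, F C & C `<=` A `&` B.

Definition is_measure E mu : Prop :=
  [/\ mu set0 = 0 /\
      (forall A B, E A -> E B -> A `&` B = set0 -> mu (A `|` B) = mu A + mu B),
      forall A, E A -> (setnorm E mu A < +oo)%E &
      forall F : set (set T), F `<=` E -> shrinking F ->
        \bigcap_(A in F) A = set0 ->
        forall e : R, 0 < e -> exists2 A, F A &
          forall B, F B -> B `<=` A -> v (mu B) < e].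

Definition is_probability E mu : Prop :=
  [/\ is_measure E mu, setnorm E mu setT = 1%E & mu setT = 1].

Definition Nfun E mu (x : T) : \bar R :=
  ereal_inf [set setnorm E mu U | U in [set U | clopen U /\ U x]].

Definition wnorm (phi : T -> \bar R) f : \bar R :=
  ereal_sup [set ((v (f x))%:E * phi x)%E | x in [set: T]].

Record simple_rep E := SimpleRep {
  sr_size : nat;
  sr_coef : 'I_sr_size -> K;
  sr_set : 'I_sr_size -> set T;
  sr_setE : forall i, E (sr_set i) }.

Definition simple_fun E (g : simple_rep E) : T -> K :=
  fun x => \sum_(i < sr_size g) sr_coef i * \1_(sr_set i) x.

Definition simple_int E mu (g : simple_rep E) : K :=
  \sum_(i < sr_size g) sr_coef i * mu (sr_set i).

Definition approximates E mu (g : nat -> simple_rep E) f : Prop :=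
  wnorm (Nfun E mu) (fun x => f x - simple_fun (g n) x) @[n --> \oo] --> 0%E.

(* [f] represents a class in [L(T, mu, K)]. *)
Definition nonarch_integrable E mu f : Prop :=
  exists g : nat -> simple_rep E, approximates mu g f.

Definition is_integral E mu f (c : K) : Prop :=
  exists g : nat -> simple_rep E, approximates mu g f /\
    v (simple_int mu (g n) - c) @[n --> \oo] --> (0 : R).

(* [f] represents [nu(dx) / mu(dx)]. *)
Definition is_density E nu mu f : Prop :=
  nonarch_integrable E mu f /\
  forall A, clopen A -> is_integral E mu (fun x => f x * \1_A x) (nu A).

(* [nu << mu] *)
Definition abs_cont E nu mu : Prop := exists f, is_density E nu mu f.

End measures.

(** * Countable products *)

Definition cylinder (X : nat -> topologicalType) (n : nat)
    (A : forall j, set (X j)) : set (prod_topology X) :=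
  [set x | forall j, (j < n)%N -> A j (x j)].

(* [m] on [E] is the product of the [m_ j] on [E_ j].  It is not required that
   [E] contain all cylinders over the [E_ j]; it contains at least those with
   clopen sides as soon as it contains the clopen sets. *)
Definition is_product_measure (K : fieldType) (X : nat -> topologicalType)
    (E_ : forall j, set (set (X j))) (m_ : forall j, set (X j) -> K)
    (E : set (set (prod_topology X))) (m : set (prod_topology X) -> K) : Prop :=
  forall (n : nat) (A : forall j, set (X j)),
    (forall j, (j < n)%N -> E_ j (A j)) -> E (cylinder n A) ->
    m (cylinder n A) = \prod_(j < n) m_ j (A j).

(* Main.v *)
(** Write [h nu] for the measure [A |-> \int_A h dnu].  By a compactness argument
    based on axiom (iii) of measures, [\sup_A |\int_A h dnu|] equals
    [\sup_x |h x| N_nu(x)] for simple [h].  Hence [lam << nu] holds exactly when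
    [lam] is a uniform limit, on clopen sets, of measures [h nu] with [h] simple;
    the "if" part uses that [K] is complete.  For measures on the product, the
    sets occurring in [h] may be replaced by finite unions of clopen boxes, and
    then the marginal of [h nu] on [X j] is again of the form [k nu_j] with [k]
    simple; so uniform approximability passes from [mu, nu] to [mu_j, nu_j].
    By the same isometry the norm of the density [rho_j] is the norm of the
    probability [mu_j], so every [beta_j] is equal to [1]. *)

Require Import Defs.
From HB Require Import structures.
From mathcomp Require Import all_boot all_order all_algebra all_field.
From mathcomp Require Import all_classical all_reals all_analysis.
From mathcomp Require Import ring.

Set Implicit Arguments.
Unset Strict Implicit.
Unset Printing Implicit Defensive.
Import Order.TTheory GRing.Theory Num.Theory.
Import numFieldNormedType.Exports.
Local Open Scope classical_set_scope.
Local Open Scope ring_scope.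

(** * Ultrametric absolute values *)

Section nonarchimedean_absolute_value.
Context {R : realType} {K : fieldType} {v : K -> R} (v_P : nonarch_abs v).
Implicit Types (x y : K) (c : R).

Lemma nonarch_ge0 x : 0 <= v x.
Proof. by case: v_P. Qed.

Lemma nonarch_eq0 x : v x = 0 -> x = 0.
Proof. by case: v_P => _ v0 _ _ /v0. Qed.

Lemma nonarch0 : v 0 = 0.
Proof. by case: v_P => _ v0 _ _; apply/v0. Qed.

Lemma nonarch_gt0 x : x != 0 -> 0 < v x.
Proof.
move=> x0; rewrite lt_neqAle nonarch_ge0 andbT eq_sym.
by apply: contra x0 => /eqP/nonarch_eq0 ->.
Qed.

Lemma nonarchM x y : v (x * y) = v x * v y.
Proof. by case: v_P. Qed.

Lemma nonarch1 : v 1 = 1.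
Proof.
have := nonarchM 1 1; rewrite mulr1 => /esym/eqP.
rewrite -subr_eq0 -{3}[v 1]mulr1 -mulrBr mulf_eq0 subr_eq0 => /orP[|/eqP//].
by move=> /eqP/nonarch_eq0/eqP; rewrite oner_eq0.
Qed.

Lemma nonarchN x : v (- x) = v x.
Proof.
suff v1 : v (-1) = 1 by rewrite -mulN1r nonarchM v1 mul1r.
have /eqP : v (-1) ^+ 2 = 1 by rewrite expr2 -nonarchM mulrNN mulr1 nonarch1.
rewrite sqrf_eq1 => /orP[/eqP//|/eqP e].
by have := nonarch_ge0 (-1); rewrite e oppr_ge0 ler10.
Qed.

Lemma nonarch_leD c x y : v x <= c -> v y <= c -> v (x + y) <= c.
Proof.
case: v_P => _ _ _ /(_ x y) h xc yc; apply: le_trans h _.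
by rewrite ge_max xc.
Qed.

Lemma nonarch_ltD c x y : v x < c -> v y < c -> v (x + y) < c.
Proof.
case: v_P => _ _ _ /(_ x y) h xc yc; apply: le_lt_trans h _.
by rewrite gt_max xc.
Qed.

Lemma nonarch_leB c x y : v x <= c -> v y <= c -> v (x - y) <= c.
Proof. by move=> xc yc; apply: nonarch_leD; rewrite ?nonarchN. Qed.

Lemma nonarch_ltB c x y : v x < c -> v y < c -> v (x - y) < c.
Proof. by move=> xc yc; apply: nonarch_ltD; rewrite ?nonarchN. Qed.

Lemma nonarch_distC x y : v (x - y) = v (y - x).
Proof. by rewrite -nonarchN opprB. Qed.

Lemma nonarch_dist_le c y x z : v (x - y) <= c -> v (y - z) <= c ->
  v (x - z) <= c.
Proof. by move=> xc yc; rewrite -(subrK y x) -addrA; exact: nonarch_leD. Qed.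

End nonarchimedean_absolute_value.

(** * Compactness arguments from the axiom on shrinking families *)

Section tau_additive.
Context {R : realType} {K : fieldType} {v : K -> R} (v_P : nonarch_abs v).
Context {T : topologicalType} {E : set (set T)}.
Context (E_ring : setring E) (E_T : E setT).
Implicit Types (I J nu : set T -> K) (A B U V W : set T) (G F : set (set T)).

Lemma algebra0 : E set0. Proof. by case: E_ring. Qed.

Lemma algebraU A B : E A -> E B -> E (A `|` B).
Proof. by case: E_ring => _ EU _; exact: EU. Qed.

Lemma algebraD A B : E A -> E B -> E (A `\` B).
Proof. by case: E_ring => _ _ ED; exact: ED. Qed.

Lemma algebraI A B : E A -> E B -> E (A `&` B).
Proof. by move=> EA EB; rewrite -setDD; do 2 apply: algebraD => //. Qed.

Lemma algebraC A : E A -> E (~` A).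
Proof. by move=> EA; rewrite -setTD; exact: algebraD. Qed.

Lemma algebra_forall_ord n (A : 'I_n -> set T) : (forall i, E (A i)) ->
  E [set x | forall i, A i x].
Proof.
elim: n A => [|n IH] A EA.
  by rewrite (_ : mkset _ = setT) //; apply/seteqP; split=> // x _ [].
rewrite (_ : mkset _ = A ord0 `&` [set x | forall i, A (lift ord0 i) x]).
  by apply: algebraI => //; exact: IH.
apply/seteqP; split=> [x Ax|x [A0 Ax] i]; first by split.
by have [j ->|->] := unliftP ord0 i.
Qed.

(** Clauses (i) and (iii) of a measure. They pass to differences, multiples and restrictions, hence
    to every measure with a simple density. *)
Definition tau_additive I : Prop :=
  [/\ I set0 = 0,
      forall A B, E A -> E B -> A `&` B = set0 -> I (A `|` B) = I A + I B &
      forall F, F `<=` E -> shrinking F -> \bigcap_(A in F) A = set0 ->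
        forall e : R, 0 < e -> exists2 A, F A &
          forall B, F B -> B `<=` A -> v (I B) < e].

(** The bound [setnorm v E I V <= c%:E], stated without extended reals. *)
Definition bounded_on I (c : R) V : Prop :=
  forall B, E B -> B `<=` V -> v (I B) <= c.

Lemma additive_split I A B : tau_additive I -> E A -> E B ->
  I A = I (A `&` B) + I (A `\` B).
Proof.
move=> [_ Iadd _] EA EB; rewrite -Iadd; first by rewrite setUIDK.
- exact: algebraI.
- exact: algebraD.
- by apply/seteqP; split=> x //= [[_ Bx] []].
Qed.

Lemma bounded_onS I c V W : V `<=` W -> bounded_on I c W -> bounded_on I c V.
Proof. by move=> VW Wc B EB BV; apply: Wc => //; exact: subset_trans VW. Qed.

Lemma bounded_onU I c V W : tau_additive I -> E V ->
  bounded_on I c V -> bounded_on I c W -> bounded_on I c (V `|` W).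
Proof.
move=> I_P EV Vc Wc B EB BVW; rewrite (additive_split I_P EB EV).
apply: (nonarch_leD v_P).
- by apply: Vc; [exact: algebraI|move=> x []].
- by apply: Wc; [exact: algebraD|move=> x [/BVW[]]].
Qed.

(* If every [A] in [F] contained a [B] with [e <= v (I B)], then the sets
   squeezed between two members of [F] would form a shrinking family along
   which [I] does not tend to [0]. *)
Lemma shrinking_bounded I F (e : R) : tau_additive I ->
  F `<=` E -> shrinking F -> \bigcap_(A in F) A = set0 -> 0 < e ->
  exists2 A, F A & bounded_on I e A.
Proof.
move=> I_P FE Fs F0 e0; have [I0 Iadd Itau] := I_P; apply: contrapT => nF.
have big A : F A -> exists B, [/\ E B, B `<=` A & e <= v (I B)].
  move=> FA; apply: contrapT => nB; apply: nF; exists A => // B EB BA.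
  by rewrite leNgt; apply/negP => eB; apply: nB; exists B; split=> //; exact: ltW.
pose F' := [set H | [/\ E H, exists2 A, F A & H `<=` A & exists2 C, F C & C `<=` H]].
have FF' A : F A -> F' A by move=> FA; split; [exact: FE|exists A|exists A].
have F'E : F' `<=` E by move=> H [].
have F's : shrinking F'.
  move=> H1 H2 [_ _ [C1 FC1 CH1]] [_ _ [C2 FC2 CH2]].
  have [C FC CC] := Fs _ _ FC1 FC2; exists C; first exact: FF'.
  by move=> x /CC[/CH1 ? /CH2 ?].
have F'0 : \bigcap_(A in F') A = set0.
  apply/seteqP; split=> // x Hx; rewrite -F0 => A FA.
  exact: Hx (FF' _ FA).
have [H0 [_ _ [C0 FC0 C0H]] H0e] := Itau F' F'E F's F'0 e e0.
have [B [EB BC0 eB]] := big _ FC0.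
(* The traces on [B] also shrink to the empty set, so for a small member [C] of [F] the part of [B]
   outside [C] still has a value of size at least [e]. *)
pose FB := [set B `&` C | C in F].
have [|||_ [C1 FC1 <-] C1e] := Itau FB _ _ _ e e0.
- by move=> _ [C FC <-]; apply: algebraI => //; exact: FE.
- move=> _ _ [C FC <-] [D FD <-]; have [H FH HCD] := Fs _ _ FC FD.
  by exists (B `&` H); [exists H|move=> x [Bx /HCD[]]].
- apply/seteqP; split=> // x Hx; rewrite -F0 => A FA.
  by have [] : (B `&` A) x by apply: Hx; exists A.
have [C FC CC] := Fs _ _ FC0 FC1.
have BCe : v (I (B `&` C)) < e.
  by apply: C1e; [exists C|move=> x [Bx /CC[]]].
have EC := FE _ FC.
have DBe : e <= v (I (B `\` C)).
  rewrite leNgt; apply/negP => De; move: eB; rewrite leNgt => /negP; apply.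
  by rewrite (additive_split I_P EB EC); exact: nonarch_ltD.
(* Both [C] and its union with the rest of [B] are squeezed sets inside [H0], so their values are
   below [e]; yet these differ by the value on the rest of [B]. *)
have F'CD : F' (C `|` (B `\` C)).
  split; first by apply: algebraU => //; exact: algebraD.
  - by exists C0 => // x [/CC[]//|[/BC0]].
  - by exists C => // x Cx; left.
have : v (I (C `|` (B `\` C)) - I C) < e.
  apply: (nonarch_ltB v_P); apply: H0e => //.
  - by move=> x [/CC[/C0H]//|[/BC0/C0H]].
  - exact: FF'.
  - by move=> x /CC[/C0H].
rewrite Iadd //; last by rewrite setDIK.
- by rewrite addrC addKr ltNge DBe.
- exact: algebraD.
Qed.

(** The complements of a cover closed under unions form a shrinking family with empty intersection.
    This replaces the extraction of a finite subcover, up to an error [e]. *)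
Lemma cover_bounded I G (e : R) : tau_additive I ->
  G `<=` E -> setU_closed G -> (forall x, exists2 W, G W & W x) -> 0 < e ->
  exists2 W, G W & bounded_on I e (~` W).
Proof.
move=> I_P GE GU Gcov e0.
have [|||_ [W GW <-] We] :=
  @shrinking_bounded I [set ~` W | W in G] e I_P _ _ _ e0.
- by move=> _ [W GW <-]; apply: algebraC; exact: GE.
- move=> _ _ [W GW <-] [W' GW' <-]; exists (~` (W `|` W')).
    by exists (W `|` W') => //; exact: GU.
  by rewrite setCU.
- apply/seteqP; split=> // x Hx; have [W GW Wx] := Gcov x.
  by apply: (Hx (~` W)) => //; exists W.
by exists W.
Qed.

(** By the ultrametric inequality the sets of [E] on which [c] bounds [I] are closed under unions;
    [cover_bounded] supplies one whose complement has the same bound. *)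
Lemma locally_bounded I (c : R) : tau_additive I -> 0 < c ->
  (forall x, exists V, [/\ E V, V x & bounded_on I c V]) ->
  bounded_on I c setT.
Proof.
move=> I_P c0 cov.
have [|||W [EW Wc] W'c] :=
  @cover_bounded I [set W | E W /\ bounded_on I c W] c I_P _ _ _ c0.
- by move=> W [].
- move=> V W [EV Vc] [EW Wc]; split; first exact: algebraU.
  exact: bounded_onU.
- by move=> x; have [V [EV Vx Vc]] := cov x; exists V.
by rewrite -(setUv W); exact: bounded_onU.
Qed.

(** The common properties of the clopen sets of a space and of the boxes of a product from which
    members of [E] are approximated. *)
Definition separating (S : set (set T)) : Prop :=
  [/\ S `<=` E, S setT, setI_closed S &
      forall x y, x <> y -> exists U, [/\ S U, U x & ~ U y]].

(** Since [x] is not in [A] and [S] separates points, the traces on [A] of the members of [S] around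
    [x] shrink to the empty set. *)
Lemma point_bounded S I A x (e : R) : separating S -> tau_additive I ->
  E A -> ~ A x -> 0 < e ->
  exists U, [/\ S U, U x & bounded_on I e (U `&` A)].
Proof.
move=> [SE ST SI Ssep] I_P EA nAx e0.
have [|||_ [U [SU Ux] <-] Ue] :=
  @shrinking_bounded I [set U `&` A | U in [set U | S U /\ U x]] e I_P
    _ _ _ e0.
- by move=> _ [U [SU _] <-]; apply: algebraI => //; exact: SE.
- move=> _ _ [U [SU Ux] <-] [V [SV Vx] <-]; exists (U `&` V `&` A).
    by exists (U `&` V) => //; split=> //; exact: SI.
  by move=> y [[]].
- apply/seteqP; split=> // y Hy; have [xy|xy] := pselect (x = y).
    have [_] : (setT `&` A) y by apply: Hy; exists setT.
    by rewrite -xy.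
  have [U [SU Ux nUy]] := Ssep _ _ xy.
  by have [] : (U `&` A) y by apply: Hy; exists U.
by exists U.
Qed.

Inductive finite_union (S : set (set T)) : set (set T) :=
  | finite_union0 : finite_union S set0
  | finite_unionS U V : S U -> finite_union S V -> finite_union S (U `|` V).

Lemma finite_unionU S : setU_closed (finite_union S).
Proof.
move=> U V; elim=> [|U1 U2 SU1 _ IH] SV; first by rewrite set0U.
by rewrite -setUA; apply: finite_unionS => //; exact: IH.
Qed.

Lemma finite_union_sub S G : G set0 -> setU_closed G -> S `<=` G ->
  finite_union S `<=` G.
Proof. by move=> G0 GU SG U; elim=> // U1 U2 /SG GU1 _; exact: GU. Qed.

(** The sets on which [A] can be approximated are closed under unions and cover the space;
    [cover_bounded] then leaves only a remainder bounded by [e]. *)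
Lemma finite_union_approximation S I A (e : R) : separating S -> tau_additive I ->
  E A -> 0 < e ->
  exists U, [/\ finite_union S U, bounded_on I e (U `\` A) &
                bounded_on I e (A `\` U)].
Proof.
move=> S_P I_P EA e0; have [SE ST SI Ssep] := S_P.
have I0 : I set0 = 0 by case: I_P.
have b0 : bounded_on I e set0.
  by move=> B _; rewrite subset0 => ->; rewrite I0 (nonarch0 v_P) ltW.
have fE : finite_union S `<=` E.
  by apply: finite_union_sub => //; [exact: algebra0|exact: algebraU].
(* The excess of [U] over [A] is measured on the whole space and only the defect is cut down to [W];
   this makes [G] stable under unions. *)
pose G := [set W | E W /\ exists U, [/\ finite_union S U,
    bounded_on I e (U `\` A) & bounded_on I e (W `&` A `\` U)]].
have [|||W [EW [U [fU UA WAU]]] We] := @cover_bounded I G e I_P _ _ _ e0.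
- by move=> W [].
- move=> W1 W2 [EW1 [U1 [fU1 UA1 WA1]]] [EW2 [U2 [fU2 UA2 WA2]]].
  split; first exact: algebraU.
  exists (U1 `|` U2); split; first exact: finite_unionU.
    by rewrite setDUl; apply: bounded_onU => //; apply: algebraD => //; exact: fE.
  apply: (bounded_onS _ (bounded_onU I_P _ WA1 WA2)).
    by move=> x [[[W1x|W2x] Ax] /not_orP[nU1 nU2]]; [left|right].
  by apply: algebraD; [exact: algebraI|exact: fE].
(* Around a point of [A] the approximant is a member of [S] almost contained in [A]; around any
   other point it is the empty set. *)
- move=> x; have [Ax|nAx] := pselect (A x).
    have [U [SU Ux UA]] : exists U, [/\ S U, U x & bounded_on I e (U `&` ~` A)].
      by apply: point_bounded => //; exact: algebraC.
    exists U => //; split; first exact: SE.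
    exists U; split => //.
      by rewrite -[U]setU0; apply: finite_unionS => //; exact: finite_union0.
    by apply: bounded_onS b0 => y [[]].
  have [U [SU Ux UA]] := point_bounded S_P I_P EA nAx e0.
  exists U => //; split; first exact: SE.
  exists set0; split; first exact: finite_union0.
    by rewrite set0D.
  by rewrite setD0.
exists U; split => //.
apply: (bounded_onS _ (bounded_onU I_P _ WAU We)).
  move=> x [Ax nUx]; have [Wx|nWx] := pselect (W x); [left|right] => //.
by apply: algebraD; [exact: algebraI|exact: fE].
Qed.

(** [I A] is [I U], minus the value on [U] outside [A], plus the value on [A] outside [U]; for a
    suitable finite union [U] all three have size at most [c]. *)
Lemma bounded_finite_union S I (c : R) : separating S -> tau_additive I ->
  0 < c -> (forall U, finite_union S U -> v (I U) <= c) -> bounded_on I c setT.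
Proof.
move=> S_P I_P c0 Sc A EA _.
have [U [fU UA AU]] := finite_union_approximation S_P I_P EA c0.
have [SE _ _ _] := S_P.
have EU : E U.
  by move: U fU {UA AU}; apply: finite_union_sub => //; [exact: algebra0|exact: algebraU].
rewrite (additive_split I_P EA EU); apply: (nonarch_leD v_P); last first.
  by apply: AU => //; exact: algebraD.
have -> : I (A `&` U) = I U - I (U `\` A).
  by rewrite (additive_split I_P EU EA) setIC addrK.
apply: (nonarch_leB v_P); first exact: Sc.
by apply: UA => //; exact: algebraD.
Qed.

Lemma tau_additiveB I J : tau_additive I -> tau_additive J ->
  tau_additive (fun A => I A - J A).
Proof.
move=> [I0 Iadd Itau] [J0 Jadd Jtau]; split.
- by rewrite I0 J0 subr0.
- by move=> A B EA EB AB; rewrite Iadd // Jadd // opprD addrACA.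
- move=> F FE Fs F0 e e0.
  have [A FA Ae] := Itau _ FE Fs F0 _ e0.
  have [B FB Be] := Jtau _ FE Fs F0 _ e0.
  have [C FC CAB] := Fs _ _ FA FB; exists C => // D FD DC.
  apply: (nonarch_ltB v_P).
  + by apply: Ae => // x /DC/CAB[].
  + by apply: Be => // x /DC/CAB[].
Qed.

Lemma tau_additiveZ (k : K) I : tau_additive I ->
  tau_additive (fun A => k * I A).
Proof.
move=> [I0 Iadd Itau]; split.
- by rewrite I0 mulr0.
- by move=> A B EA EB AB; rewrite Iadd // mulrDr.
(* Adding [1] keeps the divisor positive when [k] is zero. *)
- move=> F FE Fs F0 e e0; have k1 : 0 < v k + 1 by rewrite ltr_wpDl ?(nonarch_ge0 v_P).
  have [A FA Ae] := Itau _ FE Fs F0 (e / (v k + 1)) (divr_gt0 e0 k1).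
  exists A => // B FB BA; rewrite (nonarchM v_P).
  have := Ae _ FB BA; rewrite ltr_pdivlMr // mulrDr mulr1 mulrC.
  by apply: le_lt_trans; rewrite lerDl (nonarch_ge0 v_P).
Qed.

Lemma tau_additive_restr A I : E A -> tau_additive I ->
  tau_additive (fun B => I (A `&` B)).
Proof.
move=> EA [I0 Iadd Itau]; split.
- by rewrite setI0.
- move=> B C EB EC BC; rewrite setIUr Iadd //; try exact: algebraI.
  by rewrite setIACA BC setI0.
- move=> F FE Fs F0 e e0.
  have [|||_ [B FB <-] Be] := Itau [set A `&` B | B in F] _ _ _ e e0.
  + by move=> _ [B FB <-]; apply: algebraI => //; exact: FE.
  + move=> _ _ [B FB <-] [C FC <-]; have [D FD DBC] := Fs _ _ FB FC.
    by exists (A `&` D); [exists D|move=> x [Ax /DBC[]]].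
  + apply/seteqP; split=> // x Hx; rewrite -F0 => B FB.
    by have [] : (A `&` B) x by apply: Hx; exists B.
  by exists B => // C FC CB; apply: Be; [exists C|exact: setIS].
Qed.

End tau_additive.

Arguments tau_additive {R K} v {T} E I.
Arguments bounded_on {R K} v {T} E I c V.
Arguments separating {T} E S.

(** * Simple functions and their indefinite integrals *)

Section simple_functions.
Context {K : fieldType} {T : topologicalType} {E : set (set T)}.
Context (E_ring : setring E).
Implicit Types (nu : set T -> K) (g : simple_rep (K := K) E) (A B : set T).

(** The integral of the simple function of [g] over [A]; as a function of [A] it is the measure with
    that density with respect to [nu]. *)
Definition simple_on nu g A : K :=
  \sum_(i < sr_size g) sr_coef i * nu (sr_set i `&` A).

Lemma simple_onT nu g : simple_on nu g setT = simple_int nu g.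
Proof. by apply: eq_bigr => i _; rewrite setIT. Qed.

Definition simple_restr A (EA : E A) g : simple_rep E :=
  @SimpleRep K T E (sr_size g) (@sr_coef _ _ _ g) (fun i => sr_set i `&` A)
    (fun i => algebraI E_ring (sr_setE i) EA).

Lemma simple_fun_restr A (EA : E A) g x :
  simple_fun (simple_restr EA g) x = simple_fun g x * \1_A x.
Proof.
rewrite /simple_fun big_distrl /=; apply: eq_bigr => i _.
by rewrite indicI -mulrA.
Qed.

Lemma simple_on_restr nu A (EA : E A) g B :
  simple_on nu (simple_restr EA g) B = simple_on nu g (A `&` B).
Proof. by apply: eq_bigr => i _; rewrite /= setIA. Qed.

Definition simple_indic (k : K) A (EA : E A) : simple_rep E :=
  @SimpleRep K T E 1 (fun=> k) (fun=> A) (fun=> EA).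

Lemma simple_on_indic nu k A (EA : E A) B :
  simple_on nu (simple_indic k EA) B = k * nu (A `&` B).
Proof. by rewrite /simple_on big_ord1. Qed.

Definition simple_scale (k : K) g : simple_rep E :=
  @SimpleRep K T E (sr_size g) (fun i => k * sr_coef i) _ (@sr_setE _ _ _ g).

Lemma simple_on_scale nu k g A :
  simple_on nu (simple_scale k g) A = k * simple_on nu g A.
Proof. by rewrite /simple_on mulr_sumr; apply: eq_bigr => i _; rewrite mulrA. Qed.

Definition simple_add_set g1 g2 (i : 'I_(sr_size g1 + sr_size g2)) : set T :=
  match fintype.split i with inl a => sr_set a | inr b => sr_set b end.

Lemma simple_add_setE g1 g2 i : E (@simple_add_set g1 g2 i).
Proof. by rewrite /simple_add_set; case: fintype.split => j; exact: sr_setE. Qed.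

Definition simple_add g1 g2 : simple_rep E :=
  @SimpleRep K T E _ (fun i => match fintype.split i with
    inl a => sr_coef a | inr b => sr_coef b end) _
    (@simple_add_setE g1 g2).

Lemma simple_on_add nu g1 g2 A :
  simple_on nu (simple_add g1 g2) A = simple_on nu g1 A + simple_on nu g2 A.
Proof.
rewrite /simple_on big_split_ord; congr (_ + _); apply: eq_bigr => i _ /=;
  rewrite /simple_add_set.
- by rewrite (unsplitK (inl i)).
- by rewrite (unsplitK (inr i)).
Qed.

End simple_functions.

(** * Densities, and the isometry between weighted norms and norms of measures *)

Section densities.
Context {R : realType} {K : fieldType} {v : K -> R} (v_P : nonarch_abs v).
Context {T : topologicalType} {E : set (set T)} (E_alg : algebra_over_Bco E).
Implicit Types (I J nu lam : set T -> K) (f : T -> K) (A B : set T).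
Local Open Scope ereal_scope.

Lemma algebra_ring : setring E. Proof. by case: E_alg. Qed.

Lemma algebra_clopen A : clopen A -> E A. Proof. by case: E_alg => _; exact. Qed.

Lemma algebraT : E setT. Proof. exact/algebra_clopen/clopenT. Qed.

Let E_ring := algebra_ring.
Let E_T := algebraT.

Lemma measure_tau_additive nu : is_measure v E nu -> tau_additive v E nu.
Proof. by case=> -[]. Qed.

Lemma setnorm_leP nu A (c : R) :
  setnorm v E nu A <= c%:E <-> bounded_on v E nu c A.
Proof.
split=> [/ereal_supP h B EB BA|h]; first by rewrite -lee_fin; apply: h; exists B.
by apply: ge_ereal_sup => _ [B [EB BA] <-]; rewrite lee_fin; exact: h.
Qed.

Lemma Nfun_le nu A x : clopen A -> A x -> Nfun v E nu x <= setnorm v E nu A.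
Proof. by move=> cA Ax; apply: ereal_inf_lbound; exists A. Qed.

Lemma Nfun_ge0 nu x : 0 <= Nfun v E nu x.
Proof.
apply: le_ereal_inf_tmp => _ [A _ <-]; apply: (@le_trans _ _ (v (nu set0))%:E).
  by rewrite lee_fin (nonarch_ge0 v_P).
by apply: ereal_sup_ubound; exists set0 => //; split=> //; exact: algebra0.
Qed.

Lemma Nfun_fin_num nu x : is_measure v E nu -> Nfun v E nu x \is a fin_num.
Proof.
case=> _ nu_fin _; rewrite ge0_fin_numE ?Nfun_ge0//.
by apply: le_lt_trans (nu_fin setT E_T); apply: Nfun_le => //; exact: clopenT.
Qed.

Lemma wnorm_ub (phi : T -> \bar R) f x : (v (f x))%:E * phi x <= wnorm v phi f.
Proof. by apply: ereal_sup_ubound; exists x. Qed.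

Lemma wnorm_leP (phi : T -> \bar R) f c :
  wnorm v phi f <= c <-> forall x, (v (f x))%:E * phi x <= c.
Proof.
split=> [h x|h]; first exact: le_trans (wnorm_ub _ _ _) h.
by apply: ge_ereal_sup => _ [x _ <-].
Qed.

Lemma nonarch_mulD_le (x y : K) (r c : \bar R) : 0 <= r ->
  (v x)%:E * r <= c -> (v y)%:E * r <= c -> (v (x + y))%:E * r <= c.
Proof.
move=> r0 xc yc; have [xy|yx] := leP (v x) (v y).
- by apply: le_trans yc; apply: lee_wpmul2r => //; rewrite lee_fin (nonarch_leD v_P).
- apply: le_trans xc; apply: lee_wpmul2r => //; rewrite lee_fin.
  by rewrite (nonarch_leD v_P) // ltW.
Qed.

Lemma nonarch_mulB_le (x y : K) (r c : \bar R) : 0 <= r ->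
  (v x)%:E * r <= c -> (v y)%:E * r <= c -> (v (x - y))%:E * r <= c.
Proof. by move=> r0 xc yc; apply: nonarch_mulD_le; rewrite ?(nonarchN v_P). Qed.

(** A density relation without integrals, suited to simple functions, which are constant on small
    members of [E]. The set [V] is taken in [E] because level sets of simple functions need not be
    clopen. *)
Definition locally_density I nu f : Prop :=
  forall x, exists V, [/\ E V, V x &
    forall B, E B -> B `<=` V -> I B = (f x * nu B)%R].

Lemma locally_densityB I J nu f1 f2 : locally_density I nu f1 ->
  locally_density J nu f2 ->
  locally_density (fun A => I A - J A)%R nu (fun x => f1 x - f2 x)%R.
Proof.
move=> dI dJ x; have [V [EV Vx VI]] := dI x; have [W [EW Wx WJ]] := dJ x.
exists (V `&` W); split=> //; first exact: algebraI.
by move=> B EB BVW; rewrite VI ?WJ ?mulrBl // => y /BVW[].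
Qed.

Lemma simple_on_tau_additive nu (g : simple_rep E) : tau_additive v E nu ->
  tau_additive v E (simple_on nu g).
Proof.
case: g => n c s Es nu_P; rewrite /simple_on /=.
elim: n c s Es => [|n IH] c s Es.
  rewrite (_ : (fun _ => _) = fun A => (0 * nu A)%R); first exact: tau_additiveZ.
  by apply/funext => A; rewrite big_ord0 mul0r.
rewrite (_ : (fun _ => _) = fun A =>
  (\sum_(i < n) c (widen_ord (leqnSn n) i) * nu (s (widen_ord (leqnSn n) i) `&` A) -
   (- c ord_max) * nu (s ord_max `&` A))%R).
  apply: (tau_additiveB v_P).
    exact: (IH (c \o widen_ord (leqnSn n)) (s \o widen_ord (leqnSn n))
               (fun i => Es _)).
  apply: (tau_additiveZ v_P); exact: (tau_additive_restr E_ring).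
by apply/funext => A; rewrite big_ord_recr mulNr opprK.
Qed.

Lemma simple_on_locally_density nu (g : simple_rep E) :
  tau_additive v E nu ->
  locally_density (simple_on nu g) nu (simple_fun g).
Proof.
move=> [nu0 _ _] x.
(* The intersection of these sets is the atom of [x]: the points lying in the same sets of [g] as
   [x], where the simple function is constant. *)
pose W i := if x \in sr_set i then sr_set (s := g) i else ~` sr_set i.
exists [set y | forall i, W i y]; split.
- apply: (algebra_forall_ord E_ring E_T) => i; rewrite /W; case: ifP => _.
    exact: sr_setE.
  by apply: (algebraC E_ring E_T); exact: sr_setE.
- by move=> i; rewrite /W; case: ifPn => [|/negP xs]; rewrite ?inE // => /mem_set.
- move=> B EB BV; rewrite /simple_on /simple_fun mulr_suml; apply: eq_bigr => i _.
  rewrite indicE -mulrA; have : B `<=` W i by [move=> y /BV]; rewrite /W; case: ifP => _ Bs.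
  + by rewrite mul1r setIidr.
  + by rewrite mul0r (_ : _ `&` B = set0) ?nu0 ?mulr0 // setIC; exact/disjoints_subset.
Qed.

Context (T_sep : separating E (@clopen T)).

(** One half of the isometry. Inside [V], [nu] is [I] divided by [f x], and by [point_bounded] a
    small clopen [U] around [x] has [nu]-norm at most [e] outside [V], with [e] arbitrary. *)
Lemma density_le nu I f (c : R) : tau_additive v E nu ->
  locally_density I nu f -> (0 <= c)%R ->
  bounded_on v E I c setT ->
  forall x, (v (f x))%:E * Nfun v E nu x <= c%:E.
Proof.
move=> nu_P dI c0 Ic x; have [->|fx0] := eqVneq (f x) 0%R.
  by rewrite (nonarch0 v_P) mul0e lee_fin.
have a0 := nonarch_gt0 v_P fx0.
rewrite -lee_pdivlMl // -EFinM; apply/lee_addgt0Pr => e e0.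
have [V [EV Vx VI]] := dI x.
have [||U [cU Ux Ue]] :=
    point_bounded v_P E_ring (A := ~` V) (x := x) T_sep nu_P _ _ e0.
- exact: algebraC.
- by move=> /(_ Vx).
apply: (le_trans (Nfun_le nu cU Ux)); apply/setnorm_leP.
have q0 : (0 <= (v (f x))^-1 * c)%R by rewrite mulr_ge0 // invr_ge0 ltW.
have -> : U = (U `&` V) `|` (U `&` ~` V) by rewrite -setIUr setUv setIT.
apply: (bounded_onU v_P E_ring nu_P).
- by apply: (algebraI E_ring) => //; exact: algebra_clopen.
- move=> B EB BUV; apply: (@le_trans _ _ ((v (f x))^-1 * c)%R); last first.
    by rewrite lerDl ltW.
  rewrite ler_pdivlMl // -(nonarchM v_P) -VI //; first exact: Ic.
  by move=> y /BUV[].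
- by move=> B EB BUV; apply: le_trans (Ue B EB BUV) _; rewrite lerDr.
Qed.

(** The other half. Strict inequality yields a clopen set around [x] whose [setnorm] is below [c]
    divided by [v (f x)]; the resulting local bound is globalized by [locally_bounded]. *)
Lemma bounded_of_density nu I f (c : R) :
  tau_additive v E I -> locally_density I nu f -> (0 < c)%R ->
  (forall x, (v (f x))%:E * Nfun v E nu x < c%:E) ->
  bounded_on v E I c setT.
Proof.
move=> I_P dI c0 fc; apply: (locally_bounded v_P E_ring E_T I_P c0) => x.
have [V [EV Vx VI]] := dI x; have [fx0|fx0] := eqVneq (f x) 0%R.
  exists V; split=> // B EB BV.
  by rewrite VI // fx0 mul0r (nonarch0 v_P) ltW.
have a0 := nonarch_gt0 v_P fx0.
have := fc x; rewrite -lte_pdivlMl // -EFinM => /ereal_inf_lt[_ [U [cU Ux] <-]].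
move=> /ltW/setnorm_leP Uc; exists (V `&` U); split=> //.
  by apply: (algebraI E_ring) => //; exact: algebra_clopen.
move=> B EB BVU; rewrite VI // => [|y /BVU[] //].
by rewrite (nonarchM v_P) -ler_pdivlMl //; apply: Uc => // y /BVU[].
Qed.

Lemma cvg0e_lt (u : nat -> \bar R) (e : R) : u @ \oo --> 0 -> (0 < e)%R ->
  exists N, forall n, (N <= n)%N -> u n < e%:E.
Proof.
move=> u0 e0; have e0' : (0 : \bar R) < e%:E by rewrite lte_fin.
by have [N _ h] := u0 _ (open_ereal_lt' e0'); exists N.
Qed.

Lemma cvg0_lt (u : nat -> R) (e : R) : u @ \oo --> (0 : R)%R -> (0 < e)%R ->
  exists N, forall n, (N <= n)%N -> (u n < e)%R.
Proof. by move=> u0 e0; have [N _ h] := cvgr_lt _ u0 _ e0; exists N. Qed.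

Lemma nonarch_mulB_lt (x y : K) (r c : \bar R) : 0 <= r ->
  (v x)%:E * r < c -> (v y)%:E * r < c -> (v (x - y))%:E * r < c.
Proof.
move=> r0 xc yc; apply: (@le_lt_trans _ _ (maxe ((v x)%:E * r) ((v y)%:E * r))).
  by apply: nonarch_mulB_le; rewrite // le_max lexx ?orbT.
by rewrite gt_max xc.
Qed.

(** One simple function serves all clopen [A]. The integral over [A] is a limit along a sequence [h]
    depending on [A], and the isometry compares [h m] with the restriction of [g n] to [A]. *)
Lemma density_approx nu lam f (e : R) : tau_additive v E nu ->
  is_density v E lam nu f -> (0 < e)%R ->
  exists g : simple_rep E,
    (forall x, (v (f x - simple_fun g x))%:E * Nfun v E nu x <= e%:E) /\
    forall A, clopen A -> (v (lam A - simple_on nu g A) <= e)%R.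
Proof.
move=> nu_P [[g gf] lamf] e0.
have [n /(_ n (leqnn n)) gn] := cvg0e_lt gf e0.
have gfx x : (v (f x - simple_fun (g n) x))%:E * Nfun v E nu x < e%:E.
  exact: le_lt_trans (wnorm_ub _ _ _) gn.
exists (g n); split=> [x|A cA]; first exact: ltW.
have [h [hf hlam]] := lamf A cA.
have [m [hm1 hm2]] : exists m, wnorm v (Nfun v E nu)
    (fun x => f x * \1_A x - simple_fun (h m) x)%R < e%:E /\
    (v (simple_int nu (h m) - lam A) < e)%R.
  have [N1 h1] := cvg0e_lt hf e0; have [N2 h2] := cvg0_lt hlam e0.
  exists (maxn N1 N2); split; first by apply: h1; exact: leq_maxl.
  by apply: h2; exact: leq_maxr.
have EA := algebra_clopen cA.
rewrite (nonarch_distC v_P); apply: (nonarch_dist_le v_P (y := simple_int nu (h m))).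
  pose I B := (simple_on nu (simple_restr E_ring EA (g n)) B - simple_on nu (h m) B)%R.
  have : (v (I setT) <= e)%R.
    have I_P : tau_additive v E I.
      by apply: (tau_additiveB v_P); exact: simple_on_tau_additive.
    apply: (bounded_of_density I_P _ e0) => //.
      apply: locally_densityB; exact: simple_on_locally_density.
    move=> x; rewrite /= simple_fun_restr.
    (* The density of [I] is rearranged into two terms, each of weighted size below [e]. *)
    have -> : (simple_fun (g n) x * \1_A x - simple_fun (h m) x =
        f x * \1_A x - simple_fun (h m) x - (f x - simple_fun (g n) x) * \1_A x)%R.
      by rewrite mulrBl opprB [RHS]addrC subrKA.
    apply: nonarch_mulB_lt; first exact: Nfun_ge0.
      exact: le_lt_trans (wnorm_ub _ _ _) hm1.
    rewrite indicE; case: (x \in A); first by rewrite mulr1.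
    by rewrite mulr0 (nonarch0 v_P) mul0e lte_fin.
  by rewrite /I simple_on_restr setIT simple_onT.
exact: ltW.
Qed.

Lemma bounded_clopen I (c : R) : tau_additive v E I -> (0 < c)%R ->
  (forall A, clopen A -> (v (I A) <= c)%R) -> bounded_on v E I c setT.
Proof.
move=> I_P c0 Ic; apply: (bounded_finite_union v_P E_ring E_T T_sep I_P c0).
move=> U fU; apply: Ic; move: U fU.
by apply: finite_union_sub; [exact: clopen0|exact: clopenU|].
Qed.

(** On an empty space the empty family would be shrinking with empty intersection, while the limit
    clause asks for a member of it. A point rules out the value [-oo] of the supremum in [wnorm]. *)
Lemma tau_additive_point nu : tau_additive v E nu -> exists x : T, True.
Proof.
move=> [_ _ nutau]; apply: contrapT => T0.
have [|||A []] := nutau set0 _ _ _ 1%R ltr01.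
- exact: sub0set.
- by move=> A B [].
- by apply/seteqP; split=> // x _; apply: T0; exists x.
Qed.

Lemma wnorm_ge0 nu f : tau_additive v E nu -> 0 <= wnorm v (Nfun v E nu) f.
Proof.
move=> /tau_additive_point[x _]; apply: le_trans (wnorm_ub _ _ x).
by rewrite mule_ge0 ?Nfun_ge0 // lee_fin (nonarch_ge0 v_P).
Qed.

(** By [bounded_clopen] and [density_le], uniform approximation on clopen sets makes the simple
    functions Cauchy in the norm weighted by [Nfun]; the density is their pointwise limit. *)
Lemma abs_cont_of_approx nu lam : abs_complete v -> is_measure v E nu ->
  tau_additive v E lam ->
  (forall e : R, (0 < e)%R -> exists g : simple_rep E,
    forall A, clopen A -> (v (lam A - simple_on nu g A) <= e)%R) ->
  abs_cont v E lam nu.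
Proof.
move=> v_complete nu_meas lam_P approx.
have nu_P := measure_tau_additive nu_meas.
pose e n : R := (n.+1%:R^-1)%R.
have e0 n : (0 < e n)%R by rewrite invr_gt0.
have e_cvg : e @ \oo --> (0 : R)%R := @cvg_harmonic R.
have e_le m n : (m <= n)%N -> (e n <= e m)%R.
  by move=> mn; rewrite lef_pV2 ?posrE // ler_nat.
have [g lamg] := choice (fun n => approx _ (e0 n)).
have gle m n x : (m <= n)%N ->
    (v (simple_fun (g m) x - simple_fun (g n) x))%:E * Nfun v E nu x <= (e m)%:E.
  move=> mn.
  have dJ := locally_densityB (simple_on_locally_density (g m) nu_P)
    (simple_on_locally_density (g n) nu_P).
  apply: (density_le nu_P dJ (ltW (e0 m))).
  have I_P k : tau_additive v E (fun A => lam A - simple_on nu (g k) A)%R.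
    by apply: (tau_additiveB v_P) => //; exact: simple_on_tau_additive.
  have Ik k := bounded_clopen (I_P k) (e0 k) (lamg k).
  move=> B EB BT; apply: (nonarch_dist_le v_P (y := lam B)).
    rewrite (nonarch_distC v_P); exact: Ik.
  by apply: le_trans (e_le _ _ mn); exact: Ik.
have [f fg] : exists f : T -> K, forall x n,
    (v (f x - simple_fun (g n) x))%:E * Nfun v E nu x <= (e n)%:E.
  suff /choice[f fP] : forall x, exists l, forall n,
      (v (l - simple_fun (g n) x))%:E * Nfun v E nu x <= (e n)%:E by exists f.
  move=> x.
  have := Nfun_ge0 nu x; have := Nfun_fin_num x nu_meas; have := fun m n => gle m n x.
  case: (Nfun v E nu x) => // r gx _; rewrite lee_fin le_eqVlt => /orP[/eqP<-|r0].
    (* Where the weight vanishes any value of the density will do; [0] is taken. *)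
    by exists 0%R => n; rewrite mule0 lee_fin ltW.
  have gr m n : (m <= n)%N ->
      (v (simple_fun (g m) x - simple_fun (g n) x) <= e m / r)%R.
    by move=> mn; rewrite ler_pdivlMr // -lee_fin EFinM; exact: gx.
  have [|l ul] := v_complete (fun n => simple_fun (g n) x).
    move=> d d0; have [N /(_ N (leqnn N)) eN] := cvg0_lt e_cvg (mulr_gt0 d0 r0).
    exists N => m n Nm Nn; apply: (@le_lt_trans _ _ (e N / r)%R).
      apply: (nonarch_dist_le v_P (y := simple_fun (g N) x)); last exact: gr.
      by rewrite (nonarch_distC v_P); exact: gr.
    by rewrite ltr_pdivrMr.
  exists l => n; rewrite -EFinM lee_fin -ler_pdivlMr //.
  have [N Nl] := cvg0_lt ul (divr_gt0 (e0 n) r0).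
  (* The index is at least [N], to be close to the limit, and at least [n], so that the Cauchy
     estimate with [e n] applies. *)
  apply: (nonarch_dist_le v_P (y := simple_fun (g (maxn N n)) x)).
    rewrite (nonarch_distC v_P); apply: ltW; apply: Nl; exact: leq_maxl.
  by rewrite (nonarch_distC v_P); apply: gr; exact: leq_maxr.
have cvg0e (u : nat -> \bar R) : (forall n, 0 <= u n) ->
    (forall n, u n <= (e n)%:E) -> u @ \oo --> 0.
  move=> u0 ue; apply: (squeeze_cvge (f := fun=> 0) (h := EFin \o e)).
  - by apply: nearW => n; rewrite u0 ue.
  - exact: cvg_cst.
  - by apply: cvg_EFin => //; exact: nearW.
have wn0 h := wnorm_ge0 h nu_P.
exists f; split.
  by exists g; apply: cvg0e => // n; apply/wnorm_leP => x.
move=> A cA; exists (fun n => simple_restr E_ring (algebra_clopen cA) (g n)); split.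
  apply: cvg0e => // n; apply/wnorm_leP => x; rewrite simple_fun_restr -mulrBl.
  rewrite (nonarchM v_P) indicE; case: (x \in A); last first.
    by rewrite (nonarch0 v_P) mulr0 mul0e lee_fin ltW.
  by rewrite (nonarch1 v_P) mulr1.
apply: (squeeze_cvgr (f := fun=> 0%R) (h := e)) => //; last exact: cvg_cst.
apply: nearW => n; rewrite (nonarch_ge0 v_P) /= (nonarch_distC v_P) -simple_onT.
by rewrite simple_on_restr setIT; exact: lamg.
Qed.

(** The isometry, applied to simple approximations of [f], bounds the norm by that of [lam];
    conversely a norm below [1] would force [lam setT] to have size below [1]. *)
Lemma wnorm_probability_density nu lam f : is_measure v E nu ->
  is_probability v E lam -> is_density v E lam nu f ->
  wnorm v (Nfun v E nu) f = 1.
Proof.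
move=> nu_meas [lam_meas lam1 lamT] f_P.
have nu_P := measure_tau_additive nu_meas.
have lam_P := measure_tau_additive lam_meas.
apply/eqP; rewrite eq_le; apply/andP; split.
  (* Accuracy [1] is enough: by the ultrametric inequality an error of size [1] does not affect the
     bound [1]. *)
  apply/wnorm_leP => x; have [g [fg lamg]] := density_approx nu_P f_P ltr01.
  rewrite -(subrK (simple_fun g x) (f x)).
  apply: nonarch_mulD_le => //; first exact: Nfun_ge0.
  apply: (density_le nu_P (simple_on_locally_density g nu_P) ler01).
  apply: bounded_clopen => // [|A cA]; first exact: simple_on_tau_additive.
  rewrite -(subKr (lam A) (simple_on nu g A)).
  apply: (nonarch_leB v_P); last exact: lamg.
  have /setnorm_leP : setnorm v E lam setT <= 1%:E by rewrite lam1.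
  by apply => //; exact: algebra_clopen.
rewrite leNgt; apply/negP => f1.
(* The accuracy [c] is positive even if the norm is [0]; the gap up to [d] provides the strict
   inequality in [bounded_of_density]. *)
have [c [d [c0 cd d1 fc]]] : exists c d : R, [/\ (0 < c)%R, (c < d)%R, (d < 1)%R &
    forall x, (v (f x))%:E * Nfun v E nu x <= c%:E].
  have := wnorm_ub (Nfun v E nu) f; have := wnorm_ge0 f nu_P; move: f1.
  case: (wnorm v (Nfun v E nu) f) => // r; rewrite lee_fin lte_fin => r1 r0 fr.
  pose c := ((r + 1) / 2)%R; have [rc c1] : (r < c)%R /\ (c < 1)%R by rewrite !midf_lt.
  exists c, ((c + 1) / 2)%R; rewrite !midf_lt //; split=> //.
    exact: le_lt_trans rc.
  by move=> x; apply: le_trans (fr x) _; rewrite lee_fin ltW.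
have [g [fg lamg]] := density_approx nu_P f_P c0.
have : (v (lam setT) < 1)%R; last by rewrite lamT (nonarch1 v_P) ltxx.
rewrite -(subrK (simple_on nu g setT) (lam setT)); apply: (nonarch_ltD v_P).
  by apply: le_lt_trans (lt_trans cd d1); apply: lamg; exact: clopenT.
apply: le_lt_trans d1.
apply: (bounded_of_density (simple_on_tau_additive g nu_P)
  (simple_on_locally_density g nu_P)) => //; first exact: lt_trans cd.
move=> x; apply: (@le_lt_trans _ _ c%:E); last by rewrite lte_fin.
rewrite -(subKr (f x) (simple_fun g x)).
by apply: nonarch_mulB_le => //; exact: Nfun_ge0.
Qed.

End densities.

(** * Completeness of finite extensions *)

Section finite_extension_completeness.
Context {R : realType} {F : fieldType} {absF : F -> R} {K : fieldExtType F}.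
Context {v : K -> R} (v_P : nonarch_abs v) (vF : forall a : F, v a%:A = absF a).
Context (F_complete : abs_complete absF).
Implicit Types (U W : {vspace K}) (u : nat -> K).

Definition abs_cauchy (L : fieldType) (w : L -> R) (u : nat -> L) : Prop :=
  forall e : R, 0 < e -> exists N : nat, forall m n : nat,
    (N <= m)%N -> (N <= n)%N -> w (u m - u n) < e.

Definition tends_to u (l : K) : Prop :=
  forall e : R, 0 < e -> exists N : nat, forall n : nat, (N <= n)%N -> v (u n - l) < e.

Definition complete_subspace U : Prop :=
  forall u, (forall n, u n \in U) -> abs_cauchy v u ->
    exists2 l, l \in U & tends_to u l.

Lemma nonarch_scale (a : F) x : v (a *: x) = absF a * v x.
Proof. by rewrite -[x in LHS]mul1r scalerAl (nonarchM v_P) vF. Qed.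

(** Otherwise some sequence in [W] tends to [x]; it is Cauchy, so its limit lies in [W] and equals
    [x]. *)
Lemma complete_subspace_dist W x : complete_subspace W -> x \notin W ->
  exists2 d, 0 < d & forall w, w \in W -> d <= v (x - w).
Proof.
move=> W_complete /negP xW; apply: contrapT => nd; apply: xW.
have near_x n : exists w, w \in W /\ v (x - w) < n.+1%:R^-1.
  apply: contrapT => nw; apply: nd; exists n.+1%:R^-1 => [|w wW].
    by rewrite invr_gt0.
  by rewrite leNgt; apply/negP => xw; apply: nw; exists w.
have [w wP] := choice near_x.
have wx e : 0 < e -> exists N : nat, forall n, (N <= n)%N -> v (x - w n) < e.
  move=> e0; have [N eN] := cvg0_lt (@cvg_harmonic R) e0.
  by exists N => n Nn; apply: lt_trans (eN n Nn); have [] := wP n.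
have [||l lW wl] := W_complete w.
- by move=> n; have [] := wP n.
- move=> e e0; have [N wN] := wx e e0; exists N => m n Nm Nn.
  rewrite -(subrKA x); apply: (nonarch_ltD v_P); last exact: wN.
  by rewrite (nonarch_distC v_P); exact: wN.
suff /(nonarch_eq0 v_P)/eqP : v (x - l) = 0 by rewrite subr_eq0 => /eqP ->.
apply/eqP; rewrite eq_le (nonarch_ge0 v_P) andbT; apply/ler_addgt0Pr => e e0.
rewrite add0r; have [N1 xN] := wx e e0; have [N2 lN] := wl e e0.
apply: (nonarch_dist_le v_P (y := w (maxn N1 N2))).
- by apply/ltW/xN; exact: leq_maxl.
- by apply/ltW/lN; exact: leq_maxr.
Qed.

(* The coefficient of [x] along [W] is controlled by the distance from [x] to
   [W], so Cauchy sequences in [W + <[x]>] have Cauchy components. *)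
Lemma complete_subspace_addv W x : complete_subspace W -> x \notin W ->
  complete_subspace (W + <[x]>)%VS.
Proof.
move=> W_complete xW u uW u_cauchy.
have [d d0 dx] := complete_subspace_dist W_complete xW.
have vx0 : 0 < v x.
  by apply: (nonarch_gt0 v_P); apply: contraNneq xW => ->; exact: mem0v.
have coef_le a w : w \in W -> absF a * d <= v (w + a *: x).
  move=> wW; have [->|a0] := eqVneq a 0.
    by rewrite -vF scale0r (nonarch0 v_P) mul0r (nonarch_ge0 v_P).
  have -> : w + a *: x = a *: (x - - a^-1 *: w).
    by rewrite scaleNr opprK scalerDr scalerA mulfV // scale1r addrC.
  rewrite nonarch_scale; apply: ler_wpM2l; first by rewrite -vF (nonarch_ge0 v_P).
  by apply: dx; exact: memvZ.
have [c cP] : exists c : nat -> F, forall n, u n - c n *: x \in W.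
  suff /choice[c cP] : forall n, exists a, u n - a *: x \in W by exists c.
  move=> n; have /memv_addP[w wW [_ /vlineP[a ->] ->]] := uW n.
  by exists a; rewrite addrK.
have c_cauchy : abs_cauchy absF c.
  move=> e e0; have [N uN] := u_cauchy _ (mulr_gt0 e0 d0).
  exists N => m n Nm Nn; rewrite -(ltr_pM2r d0).
  apply: le_lt_trans (uN m n Nm Nn).
  apply: le_trans (coef_le _ _ (memvB (cP m) (cP n))) _.
  have -> // : u m - c m *: x - (u n - c n *: x) + (c m - c n) *: x = u m - u n.
  by rewrite scalerBl; ring.
have [a ca] := F_complete c_cauchy.
have cx_tends : tends_to (fun n => c n *: x) (a *: x).
  move=> e e0; have [N cN] := cvg0_lt ca (divr_gt0 e0 vx0).
  exists N => n Nn; rewrite -scalerBl nonarch_scale -ltr_pdivlMr //.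
  exact: cN.
have [||w wW w_tends] := W_complete (fun n => u n - c n *: x).
- exact: cP.
- move=> e e0; have [N1 uN] := u_cauchy e e0; have [N2 cN] := cx_tends e e0.
  exists (maxn N1 N2) => m n; rewrite !geq_max => /andP[m1 m2] /andP[n1 n2].
  have -> : u m - c m *: x - (u n - c n *: x) =
      (u m - u n) - ((c m *: x - a *: x) - (c n *: x - a *: x)) by ring.
  apply: (nonarch_ltB v_P); first exact: uN.
  by apply: (nonarch_ltB v_P); exact: cN.
exists (w + a *: x); first by rewrite memv_add // memvZ ?memv_line.
move=> e e0; have [N1 wN] := w_tends e e0; have [N2 cN] := cx_tends e e0.
exists (maxn N1 N2) => n; rewrite geq_max => /andP[n1 n2].
rewrite -(subrK (c n *: x) (u n)) opprD addrACA.
by apply: (nonarch_ltD v_P); [exact: wN|exact: cN].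
Qed.

(** Induction on a bound for the dimension: the line through a nonzero vector of [U] is split off,
    leaving a complement of smaller dimension. *)
Lemma complete_subspace_all U : complete_subspace U.
Proof.
move: {2}(\dim U) (leqnn (\dim U)) => n; elim: n U => [|n IH] U.
  rewrite leqn0 dimv_eq0 => /eqP -> u u0 _; exists 0; first exact: mem0v.
  move=> e e0; exists 0%N => m _; have := u0 m; rewrite memv0 => /eqP ->.
  by rewrite subr0 (nonarch0 v_P).
move=> Un; have [U0|U0] := eqVneq U 0%VS; first by apply: IH; rewrite U0 dimv0.
pose x := vpick U; have xU : x \in U := memv_pick U.
have x0 : x != 0 by rewrite vpick0.
have Ux : (U :&: <[x]> = <[x]>)%VS by apply/capv_idPr; rewrite -memvE.
rewrite -(addv_diff_cap U <[x]>) Ux; apply: complete_subspace_addv.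
  apply: IH; have := dimv_cap_compl U <[x]>; rewrite Ux dim_vline x0 add1n => Ud.
  by rewrite -ltnS Ud.
apply/negP => xW; have : x \in ((U :\: <[x]>) :&: <[x]>)%VS.
  by rewrite memv_cap xW memv_line.
by rewrite capv_diff memv0 (negPf x0).
Qed.

Lemma finite_extension_complete : abs_complete v.
Proof.
move=> u u_cauchy.
have [||l _ ul] := complete_subspace_all (U := fullv) (u := u).
- by move=> n; exact: memvf.
- exact: u_cauchy.
exists l; apply/cvgrPdist_lt => e e0; have [N uN] := ul e e0.
by exists N => // n Nn; rewrite sub0r normrN ger0_norm ?(nonarch_ge0 v_P) // uN.
Qed.

End finite_extension_completeness.

(** * Clopen sets in zero-dimensional spaces *)

Section zero_dimensional.
Implicit Types (T : topologicalType).

(** Dimension [0] provides open neighbourhoods with empty frontier, and these are closed. *)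
Lemma zero_dim_clopen T (x : T) V : has_ind 0 T -> open V -> V x ->
  exists U, [/\ clopen U, U x & U `<=` V].
Proof.
move=> [T0 _] oV Vx; have [U [oU Ux UV fr0]] := T0 x V oV Vx.
exists U; split=> //; split=> //; apply/closure_id/seteqP; split.
  exact: subset_closure.
move=> y Uy; apply: contrapT => nUy.
have frU : y \in closure U `\` U by apply/mem_set.
have : [set: set_type (closure U `\` U)] (exist _ y frU) by [].
by rewrite [X in X _]fr0.
Qed.

Lemma clopen_separates_points T (x y : T) : T1_completely_regular T ->
  has_ind 0 T -> x <> y -> exists U, [/\ clopen U, U x & ~ U y].
Proof.
move=> [T1 _] T0 /eqP/T1[V [oV]]; rewrite !inE => Vx nVy.
have [U [cU Ux UV]] := zero_dim_clopen T0 oV Vx.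
by exists U; split=> // /UV.
Qed.

Lemma separating_clopen T (E : set (set T)) : T1_completely_regular T ->
  has_ind 0 T -> algebra_over_Bco E -> separating E (@clopen T).
Proof.
move=> T1 T0 [_ EB]; split=> //; [exact: clopenT|exact: clopenI|] => x y.
exact: clopen_separates_points.
Qed.

End zero_dimensional.

(** * Clopen boxes in the product *)

Section boxes.
Context {X : nat -> topologicalType}.
Implicit Types (A B : forall j, set (X j)).

Lemma clopen_cylinder n A : (forall i, clopen (A i)) -> clopen (cylinder n A).
Proof.
move=> cA; elim: n => [|n IH].
  by rewrite (_ : cylinder 0 A = setT); [exact: clopenT|apply/seteqP; split].
rewrite (_ : cylinder n.+1 A = cylinder n A `&` (proj n) @^-1` A n).
  apply: clopenI => //; apply: preimage_clopen => //; exact: proj_continuous.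
apply/seteqP; split=> [x xA|x [xA xn] i].
  by split=> [i ni|]; apply: xA => //; exact: ltnW.
by rewrite ltnS leq_eqVlt => /orP[/eqP ->|/xA].
Qed.

(** The condition on [p.1] makes [j] a constrained coordinate, so intersecting with a
    [coord_preimage] at [j] changes one side only. *)
Definition box j : set (set (prod_topology X)) :=
  [set cylinder p.1 p.2 | p in
    [set p : nat * (forall i, set (X i)) | (j < p.1)%N /\ forall i, clopen (p.2 i)]].

Lemma box_clopen j : box j `<=` @clopen _.
Proof. by move=> _ [[n A] [_ cA] <-]; exact: clopen_cylinder. Qed.

Definition coord_preimage j (A : set (X j)) : set (prod_topology X) :=
  [set x | A (x j)].

Lemma cylinder_dfwithI j n A (B : set (X j)) : (j < n)%N ->
  cylinder n A `&` coord_preimage B =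
  cylinder n (dfwith A j (A j `&` B)).
Proof.
move=> jn; apply/seteqP; split=> [x [xA xB] i ni|x xA].
  by move: ni; case: dfwithP => [|k _] kn; [split=> //|]; exact: xA.
split=> [i ni|]; last by have := xA j jn; rewrite dfwithin => -[].
have := xA i ni; have [<-|ji] := eqVneq j i; first by rewrite dfwithin => -[].
by rewrite dfwithout.
Qed.

Lemma coord_preimageE j (B : set (X j)) :
  coord_preimage B = cylinder j.+1 (dfwith (fun=> setT) j B).
Proof.
rewrite -[B in RHS]setTI -(cylinder_dfwithI (fun=> setT)) //.
by apply/seteqP; split=> [x xB|x []].
Qed.

Lemma clopen_dfwith A j (B : set (X j)) : (forall i, clopen (A i)) ->
  clopen B -> forall i, clopen (dfwith A j B i).
Proof. by move=> cA cB i; case: dfwithP => [|k _]; [exact: cB|exact: cA]. Qed.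

Lemma boxI j : setI_closed (box j).
Proof.
move=> _ _ [[n A] [/= jn cA] <-] [[m B] [/= jm cB] <-].
(* A cylinder leaves the coordinates beyond its length free, so its sides there are replaced by
   [setT]. *)
pose C i := (if (i < n)%N then A i else setT) `&` (if (i < m)%N then B i else setT).
exists (maxn n m, C) => /=.
  split=> [|i]; first by rewrite leq_max jn.
  by apply: clopenI; case: ifP => // _; exact: clopenT.
apply/seteqP; split=> [x xC|x [xA xB] i _].
  split=> i il; have := xC i; rewrite leq_max il ?orbT => /(_ isT);
    by rewrite /C il => -[].
by split; case: ifP => // il; [exact: xA|exact: xB].
Qed.

Lemma separating_box E j : (forall i, T1_completely_regular (X i)) ->
  (forall i, has_ind 0 (X i)) -> algebra_over_Bco E -> separating E (box j).
Proof.
move=> X1 X0 [_ EB]; split.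
- by move=> U /box_clopen/EB.
- exists (j.+1, fun=> setT) => /=; first by split=> // i; exact: clopenT.
  by apply/seteqP; split.
- exact: boxI.
- move=> x y xy; have [i xyi] : exists i, x i <> y i.
    apply: contrapT => nxy; apply: xy; apply: functional_extensionality_dep => i.
    by apply: contrapT => xyi; apply: nxy; exists i.
  have [U [cU Ux nUy]] := clopen_separates_points (X1 i) (X0 i) xyi.
  exists (cylinder (maxn i.+1 j.+1) (dfwith (fun=> setT) i U)); split.
  + exists (maxn i.+1 j.+1, dfwith (fun=> setT) i U) => //=; split.
      exact: leq_maxr.
    by apply: clopen_dfwith => // k; exact: clopenT.
  + by move=> k _; case: dfwithP.
  + by move=> /(_ i (leq_maxl _ _)); rewrite dfwithin.
Qed.

End boxes.

(** * Marginals of measures with simple density *)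

Section marginals.
Context {R : realType} {K : fieldType} {v : K -> R} (v_P : nonarch_abs v).
Context {X : nat -> topologicalType} {E_ : forall j, set (set (X j))}.
Context {nu_ : forall j, set (X j) -> K}.
Context {E : set (set (prod_topology X))} {nu : set (prod_topology X) -> K}.
Context (X_cr : forall j, T1_completely_regular (X j)).
Context (X_ind0 : forall j, has_ind 0 (X j)).
Context (E_P : forall j, algebra_over_Bco (@E_ j)) (EP : algebra_over_Bco E).
Context (nu_P : tau_additive v E nu).
Context (nu_prod : is_product_measure (@E_) (@nu_) E nu).

Let E_ring : setring E := algebra_ring EP.

Lemma clopen_coord_preimage j (A : set (X j)) : clopen A ->
  clopen (coord_preimage A).
Proof.
move=> cA; rewrite coord_preimageE; apply: clopen_cylinder.
by apply: clopen_dfwith => // i; exact: clopenT.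
Qed.

Lemma product_measure_cylinder n (A : forall i, set (X i)) :
  (forall i, clopen (A i)) -> nu (cylinder n A) = \prod_(i < n) nu_ (A i).
Proof.
move=> cA; apply: nu_prod => [i _|]; apply: algebra_clopen => //.
exact: clopen_cylinder.
Qed.

Lemma product_measure_coord_preimage j (A : set (X j)) : clopen A ->
  (forall i, nu_ (@setT (X i)) = 1) -> nu (coord_preimage A) = nu_ A.
Proof.
move=> cA nu1; rewrite coord_preimageE product_measure_cylinder; last first.
  by apply: clopen_dfwith => // i; exact: clopenT.
rewrite big_ord_recr /= dfwithin big1 ?mul1r // => i _.
by rewrite dfwithout // gtn_eqF.
Qed.

(** The sides other than the one at [j] contribute a constant factor, so the marginal is a multiple
    of [nu_ j] restricted to the side at [j]. *)
Lemma box_marginal j (B : set (prod_topology X)) : box j B ->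
  exists k : simple_rep (@E_ j), forall A, clopen A ->
    nu (B `&` coord_preimage A) = simple_on (@nu_ j) k A.
Proof.
case=> -[n C] [/= jn cC] <-.
exists (simple_indic (\prod_(i < n | i != Ordinal jn) nu_ (C i))
  (algebra_clopen (E_P j) (cC j))) => A cA.
rewrite cylinder_dfwithI // product_measure_cylinder; last first.
  by apply: clopen_dfwith => //; exact: clopenI.
rewrite simple_on_indic (bigD1 (Ordinal jn)) //= dfwithin mulrC; congr (_ * _).
by apply: eq_bigr => i; rewrite -val_eqE /= => ij; rewrite dfwithout // eq_sym.
Qed.

(* Inclusion-exclusion over boxes: the intersection of two boxes is a box. *)
Lemma finite_union_box_marginal j (U : set (prod_topology X)) :
  finite_union (box j) U -> forall B, box j B ->
  exists k : simple_rep (@E_ j), forall A, clopen A ->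
    nu (U `&` B `&` coord_preimage A) = simple_on (@nu_ j) k A.
Proof.
elim=> [B _|U1 U2 bU1 fU2 IH B bB].
  exists (simple_indic 0 (algebra0 (algebra_ring (E_P j)))) => A _.
  by rewrite !set0I simple_on_indic mul0r; case: nu_P.
have [k1 k1P] := box_marginal (boxI bU1 bB).
have [k2 k2P] := IH _ bB.
(* The overlap term. The box [B] is general in the induction so that it can be replaced here by its
   intersection with [U1]. *)
have [k3 k3P] := IH _ (boxI bU1 bB).
exists (simple_add k1 (simple_add k2 (simple_scale (-1) k3))) => A cA.
rewrite !simple_on_add simple_on_scale mulN1r -k1P // -k2P // -k3P //.
have Ebox C : box j C -> E C by move=> /box_clopen; exact: algebra_clopen.
have EU2 : E U2.
  move: U2 fU2 {IH k2P k3P}; apply: finite_union_sub => //.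
  - exact: algebra0.
  - exact: algebraU.
set P := coord_preimage A; have EP' : E P.
  by apply: (algebra_clopen EP); exact: clopen_coord_preimage.
have EI C D : E C -> E D -> E (C `&` D) := algebraI E_ring (A := C) (B := D).
have EU1 := Ebox _ bU1; have EB := Ebox _ bB.
have EU := algebraU E_ring EU1 EU2.
rewrite (additive_split E_ring nu_P (EI _ _ (EI _ _ EU EB) EP') EU1).
congr (nu _ + _).
  apply/seteqP; split=> [x [[[_ Bx] Px] U1x]|x [[U1x Bx] Px]] //.
  by split=> //; split=> //; split=> //; left.
rewrite (additive_split E_ring nu_P (EI _ _ (EI _ _ EU2 EB) EP') EU1).
rewrite addrAC (_ : _ `&` U1 = U2 `&` (U1 `&` B) `&` P) ?subrr ?add0r.
  congr nu; apply/seteqP; split=> [x [[[[//|U2x] Bx] Px] nU1]|x [[[U2x Bx] Px] nU1]] //.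
  by split=> //; split=> //; split=> //; right.
by apply/seteqP; split=> [x [[[U2x Bx] Px] U1x]|x [[U2x [U1x Bx]] Px]].
Qed.

(** [S] is replaced by a finite union [U] of boxes. The error comes from subsets of the two
    differences of [S] and [U], on which [e] bounds [nu], so it is uniform in [A]. *)
Lemma set_marginal j (S : set (prod_topology X)) (e : R) : E S -> 0 < e ->
  exists k : simple_rep (@E_ j), forall A, clopen A ->
    v (nu (S `&` coord_preimage A) - simple_on (@nu_ j) k A) <= e.
Proof.
move=> ES e0; have box_sep := separating_box j X_cr X_ind0 EP.
have [U [fU US SU]] := finite_union_approximation v_P E_ring (algebraT EP) box_sep nu_P ES e0.
have [SE ST _ _] := box_sep.
have EU : E U.
  move: U fU {US SU}; apply: finite_union_sub => //.
  - exact: algebra0.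
  - exact: algebraU.
have [k kP] := finite_union_box_marginal fU ST.
exists k => A cA; rewrite -kP // setIT.
set P := coord_preimage A; have EP' : E P.
  by apply: (algebra_clopen EP); exact: clopen_coord_preimage.
have EI C D : E C -> E D -> E (C `&` D) := algebraI E_ring (A := C) (B := D).
rewrite (additive_split E_ring nu_P (EI _ _ ES EP') EU).
rewrite (additive_split E_ring nu_P (EI _ _ EU EP') ES).
have -> : S `&` P `&` U = U `&` P `&` S by rewrite setIAC [S `&` U]setIC setIAC.
rewrite opprD addrACA subrr add0r; apply: (nonarch_leB v_P).
- by apply: SU => [|x [[]]//]; apply: algebraD => //; exact: EI.
- by apply: US => [|x [[]]//]; apply: algebraD => //; exact: EI.
Qed.

(** Terms are added one at a time; by the ultrametric inequality errors do not accumulate, and [e]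
    is divided only to offset the size of a coefficient. *)
Lemma simple_marginal j (g : simple_rep E) (e : R) : 0 < e ->
  exists k : simple_rep (@E_ j), forall A, clopen A ->
    v (simple_on nu g (coord_preimage A) - simple_on (@nu_ j) k A) <= e.
Proof.
case: g => n c s Es e0; rewrite /simple_on /=.
elim: n c s Es => [|n IH] c s Es.
  exists (simple_indic 0 (algebra0 (algebra_ring (E_P j)))) => A _.
  by rewrite -/(simple_on _ _ _) simple_on_indic mul0r big_ord0 subr0 (nonarch0 v_P) ltW.
have [k1 k1P] := IH (c \o widen_ord (leqnSn n)) (s \o widen_ord (leqnSn n))
  (fun i => Es _).
have c0 : 0 < v (c ord_max) + 1 by rewrite ltr_wpDl // (nonarch_ge0 v_P).
have [k2 k2P] := set_marginal j (Es ord_max) (divr_gt0 e0 c0).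
exists (simple_add k1 (simple_scale (c ord_max) k2)) => A cA.
rewrite -/(simple_on _ _ _) simple_on_add simple_on_scale big_ord_recr /=.
rewrite opprD addrACA -mulrBr; apply: (nonarch_leD v_P); first exact: k1P.
rewrite (nonarchM v_P); apply: (@le_trans _ _ (v (c ord_max) * (e / (v (c ord_max) + 1)))).
  by apply: ler_wpM2l; [exact: (nonarch_ge0 v_P)|exact: k2P].
rewrite mulrCA ler_piMr ?(ltW e0) // ler_pdivrMr // mul1r.
by rewrite lerDl.
Qed.


End marginals.

(** * Passage to the factors and convergence of the product of norms *)

Theorem theorem3p6 (R : realType) (s : nat)
    (Qs : fieldType) (absQ : Qs -> R) (Ks : fieldExtType Qs) (absK : Ks -> R)
    (X : nat -> topologicalType)
    (E_ : forall j, set (set (X j))) (mu_ nu_ : forall j, set (X j) -> Ks)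
    (E : set (set (prod_topology X))) (mu nu : set (prod_topology X) -> Ks)
    (s_prime : prime s)
    (KsP : is_finite_ext_of_Qs s absQ absK)
    (X_cr : forall j, T1_completely_regular (X j))
    (X_ind0 : forall j, has_ind 0 (X j))
    (E_P : forall j, algebra_over_Bco (E_ j))
    (mu_P : forall j, is_probability absK (E_ j) (mu_ j))
    (nu_P : forall j, is_probability absK (E_ j) (nu_ j))
    (EP : algebra_over_Bco E)
    (muP : is_probability absK E mu)
    (nuP : is_probability absK E nu)
    (mu_prod : is_product_measure E_ mu_ E mu)
    (nu_prod : is_product_measure E_ nu_ E nu) :
  abs_cont absK E mu nu ->
  (forall j, abs_cont absK (E_ j) (mu_ j) (nu_ j)) /\
  exists2 beta : R, 0 < beta &
    forall rho : forall j, X j -> Ks,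
      (forall j, is_density absK (E_ j) (mu_ j) (nu_ j) (rho j)) ->
      (\prod_(j < n) wnorm absK (Nfun absK (E_ j) (nu_ j)) (rho j))%E
        @[n --> \oo] --> beta%:E.
Proof.
have [[_ _ Q_complete _] K_P KQ] := KsP.
have K_complete := finite_extension_complete K_P KQ Q_complete.
have sep j := separating_clopen (X_cr j) (X_ind0 j) (E_P j).
move=> [f f_P]; split=> [j|].
  have [nu_meas _ _] := nuP; have [nuj_meas _ _] := nu_P j.
  have [muj_meas _ _] := mu_P j.
  have nu_tau := measure_tau_additive nu_meas.
  (* It suffices to approximate [mu_ j] uniformly on clopen sets; the approximants are approximate
     marginals of a simple density for [mu]. *)
  apply: (abs_cont_of_approx K_P (E_P j) (sep j) K_complete nuj_meas).
    exact: measure_tau_additive.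
  move=> e e0.
  have [g [_ gP]] := density_approx K_P EP nu_tau f_P e0.
  have [k kP] := simple_marginal K_P X_cr X_ind0 E_P EP nu_tau nu_prod j g e0.
  exists k => A cA; apply: (nonarch_dist_le K_P (y := simple_on nu g (coord_preimage A))).
    rewrite -(product_measure_coord_preimage E_P EP mu_prod cA).
      by apply: gP; exact: clopen_coord_preimage.
    by move=> i; have [_ _] := mu_P i.
  exact: kP.
(* Every factor is [1] for any choice of densities, so the partial products are constant. *)
exists 1 => // rho rho_P.
rewrite (_ : (fun n => _) = fun=> 1%E); first exact: cvg_cst.
apply/funext => n; apply: big1 => i _.
have [nui_meas _ _] := nu_P i.
exact: (wnorm_probability_density K_P (E_P i) (sep i) nui_meas (mu_P i) (rho_P i)).
Qed.
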